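(* Let $\mathbf{A}$ be a normed algebra (real or complex) with a unity $1$, let $\gamma \in \mathbb{C}$ with $|\gamma| = 1$, and let $\{c_n\}_{n \in \mathbb{Z}}$ be an $\mathbf{A}$-valued cosine sequence such that $$\sup_{n \in \mathbb{Z}} \| c_n - c_n^{(\gamma)} \| < 1,$$ where $c_n^{(\gamma)} = \frac{\gamma^n + \gamma^{-n}}{2}$ for $n \in \mathbb{Z}$. Then $c_n = c_n^{(\gamma)}$ for each $n \in \mathbb{Z}$.
   Context: A normed algebra is an associative algebra over $\mathbb{R}$ or $\mathbb{C}$ with a submultiplicative norm; completeness is not assumed. A scalar $\lambda$ is identified with the element $\lambda \cdot 1$ of $\mathbf{A}$. Note that for $|\gamma|=1$ one has $c_n^{(\gamma)} = \operatorname{Re}\gamma^n \in \mathbb{R}$, so $c_n^{(\gamma)}$ is a scalar of $\mathbf{A}$ also when $\mathbf{A}$ is a real algebra. An $\mathbf{A}$-valued cosine sequence is a family $\{c_n\}_{n\in\mathbb{Z}}$ in $\mathbf{A}$ such that $c_0 = 1$ and $2c_m c_n = c_{m+n} + c_{m-n}$ for all $m,n \in \mathbb{Z}$. *)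

(* Defs.v *)
From mathcomp Require Import all_boot all_order all_algebra.
From mathcomp Require Import all_classical all_reals all_analysis.
From mathcomp Require Import complex.

Set Implicit Arguments.
Unset Strict Implicit.
Unset Printing Implicit Defensive.

Import Order.TTheory GRing.Theory Num.Theory.

Local Open Scope ring_scope.
Local Open Scope complex_scope.

(** [abs] is the absolute value of the scalars, so that one real-valued notion
    covers [K = R] and [K = R[i]] (where the norm of the library is [R[i]]-valued
    and [abs k] is [Re `|k|]).  Nonnegativity and [nrm 0 = 0] follow from
    these axioms, as in [Lmodule_isNormed].  The value of [nrm 1] is left free. *)
Record is_algebra_norm (R : realType) (K : numFieldType) (abs : K -> R)
    (A : algType K) (nrm : A -> R) : Prop := IsAlgebraNorm {
  alg_norm_eq0 : forall x : A, nrm x = 0 -> x = 0;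
  alg_normD : forall x y : A, nrm (x + y) <= nrm x + nrm y;
  alg_normZ : forall (k : K) (x : A), nrm (k *: x) = abs k * nrm x;
  alg_normM : forall x y : A, nrm (x * y) <= nrm x * nrm y
}.

Definition cosine_sequence (A : nzRingType) (c : int -> A) : Prop :=
  c 0 = 1 /\ forall m n : int, 2 * c m * c n = c (m + n) + c (m - n).

Definition scalar_cosine (R : rcfType) (gamma : R[i]) (n : int) : R[i] :=
  (gamma ^ n + gamma ^ (- n)) / 2.

(** On the unit circle [scalar_cosine gamma n] is real, so that its real part
    is the corresponding scalar of a real algebra. *)
Lemma scalar_cosine_real (R : rcfType) (gamma : R[i]) (n : int) :
  `|gamma| = 1 ->
  scalar_cosine gamma n = (complex.Re (scalar_cosine gamma n))%:C /\
  complex.Re (scalar_cosine gamma n) = complex.Re (gamma ^ n).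
Proof.
move=> g1.
have cg : (gamma^*)%C = gamma^-1.
  have g0 : gamma != 0 by rewrite -normr_eq0 g1 oner_neq0.
  by apply: (mulfI g0); rewrite -sqr_normc g1 expr1n divff.
have cgn : gamma ^ (- n) = ((gamma ^ n)^*)%C.
  rewrite -exprz_inv -cg.
  case: n => k; rewrite /exprz; first by rewrite rmorphXn.
  by rewrite fmorphV rmorphXn.
rewrite /scalar_cosine cgn.
case: (gamma ^ n) => a b; rewrite [conjc _]/=.
have -> : (a +i* b + a -i* b) / 2 = a%:C :> R[i].
  have -> : a +i* b + a -i* b = a%:C * 2 :> R[i].
    by apply/eqP; rewrite mulr_natr mulr2n eq_complex /= subrr addr0 !eqxx.
  by rewrite mulfK // pnatr_eq0.
by split.
Qed.

(* Main.v *)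
(* Two bounded commuting cosine sequences b, c of a normed ring with
    |c n - b n| <= r < 1 are equal.  Put d = c - b and x = d 1.  Then
      2 (d m)^2 = 2 + c (2 m) + b (2 m) - 4 (b m) (c m),
    and the means of the last term vanish on x by telescoping.  The means of
    c (2 m) are 0 on (c 2 - 1) z, and 1 on z if (c 2) z = z; likewise for b.
    So the means of 2 (d m)^2 on z = (b 2 - 1) (c 2 - 1) x are 2 z, while their
    norm is at most 2 r^2 |z|; hence z = 0.  The same argument, with means
    3, 3 and 4 in place of 2, kills (c 2 - 1) x, (b 2 - 1) x and x. *)
Require Import Defs.
From mathcomp Require Import all_boot all_order all_algebra.
From mathcomp Require Import all_classical all_reals all_analysis.
From mathcomp Require Import complex.
From mathcomp Require Import ring.

Import Order.TTheory GRing.Theory Num.Theory.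

Local Open Scope classical_set_scope.
Local Open Scope ring_scope.
Local Open Scope complex_scope.

Section CommutingCosineSequences.
Set Implicit Arguments.
Unset Strict Implicit.

Context (R : realType) (A : nzRingType) (nrm : A -> R).
Hypothesis nrm_eq0 : forall x, nrm x = 0 -> x = 0.
Hypothesis nrmD : forall x y, nrm (x + y) <= nrm x + nrm y.
Hypothesis nrmN : forall x, nrm (- x) = nrm x.
Hypothesis nrmMn : forall x n, nrm (x *+ n) = n%:R * nrm x.
Hypothesis nrmM : forall x y, nrm (x * y) <= nrm x * nrm y.

Implicit Types (u v : nat -> A) (b c : int -> A) (w x y z : A).

(** * Bounded sequences in a normed ring *)

Lemma nrm_zero : nrm 0 = 0.
Proof. by rewrite -[0 in LHS](mulr0n 0) nrmMn mul0r. Qed.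

Lemma nrm_nneg x : 0 <= nrm x.
Proof.
by have := nrmD x (- x); rewrite subrr nrm_zero nrmN -mulr2n pmulrn_lge0.
Qed.

Lemma nrm_sum_le (F : nat -> A) (C : R) n :
  (forall i, nrm (F i) <= C) -> nrm (\sum_(i < n) F i) <= n%:R * C.
Proof.
move=> FC; elim: n => [|n IH]; first by rewrite big_ord0 nrm_zero mul0r.
rewrite big_ord_recr /= -natr1 mulrDl mul1r.
exact: le_trans (nrmD _ _) (lerD IH (FC n)).
Qed.

Definition bounded_seq (I : Type) (u : I -> A) :=
  exists C : R, forall n, nrm (u n) <= C.

Lemma bounded_seqD (I : Type) (u v : I -> A) :
  bounded_seq u -> bounded_seq v -> bounded_seq (fun n => u n + v n).
Proof.
move=> [C uC] [D vD]; exists (C + D) => n.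
exact: le_trans (nrmD _ _) (lerD (uC n) (vD n)).
Qed.

Lemma bounded_seqN (I : Type) (u : I -> A) :
  bounded_seq u -> bounded_seq (fun n => - u n).
Proof. by move=> [C uC]; exists C => n; rewrite nrmN. Qed.

Lemma bounded_seqM (I : Type) (u v : I -> A) :
  bounded_seq u -> bounded_seq v -> bounded_seq (fun n => u n * v n).
Proof.
move=> [C uC] [D vD]; exists (C * D) => n.
by apply: le_trans (nrmM _ _) (ler_pM _ _ (uC n) (vD n)); exact: nrm_nneg.
Qed.

Lemma bounded_seq_cst (I : Type) x : bounded_seq (fun _ : I => x).
Proof. by exists (nrm x). Qed.

(** [A] is only a ring, so the factor 2 of the cosine equation is divided out on the side of the
    real-valued norm. *)
Lemma bounded_seq_half (I : Type) (u : I -> A) :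
  bounded_seq (fun n => u n *+ 2) -> bounded_seq u.
Proof.
move=> [C uC]; exists (C / 2) => n.
by rewrite ler_pdivlMr// mulrC -nrmMn.
Qed.

(** * Cesaro means *)

(* [has_mean u z k] says that the Cesaro means of [u m * z] converge to
    [k z], with error [O(1/N)]. *)
Definition has_mean u z k :=
  bounded_seq (fun N => (\sum_(m < N) u m) * z - z *+ (k * N)).

Lemma has_mean_telescope u v z : bounded_seq v ->
  (forall m, (u m * z) *+ 2 = v m.+1 - v m) -> has_mean u z 0.
Proof.
move=> bv uv; apply: bounded_seq_half.
have [C vC] := bounded_seqD bv (bounded_seqN (bounded_seq_cst nat (v 0))).
exists C => N; apply: le_trans (vC N).
rewrite mul0n mulr0n subr0 big_distrl/= -sumrMnl.
under eq_bigr => i _ do rewrite uv.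
by rewrite -(big_mkord xpredT (fun i => v i.+1 - v i)) telescope_sumr.
Qed.

Lemma has_mean_fix u z k : (forall m, u m * z = z *+ k) -> has_mean u z k.
Proof.
move=> uz; exists 0 => N; rewrite big_distrl/=.
under eq_bigr => i _ do rewrite uz.
by rewrite sumr_const card_ord -mulrnA subrr nrm_zero.
Qed.

Lemma has_meanD u v z k l : has_mean u z k -> has_mean v z l ->
  has_mean (fun m => u m + v m) z (k + l).
Proof.
move=> uz vz; have [C uvC] := bounded_seqD uz vz; exists C => N.
apply: le_trans (uvC N).
by rewrite big_split/= mulrDl mulnDl mulrnDr addrACA opprD.
Qed.

Lemma has_mean0Z u x z : has_mean u z 0 -> has_mean (fun m => x * u m) z 0.
Proof.
move=> uz.
have [C xC] := bounded_seqM (bounded_seq_cst nat x) uz; exists C => N.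
by apply: le_trans (xC N); rewrite -big_distrr/= mul0n !mulr0n !subr0 mulrA.
Qed.

Lemma has_mean_mulr u z w k : has_mean u z k -> has_mean u (z * w) k.
Proof.
move=> uz.
have [C zC] := bounded_seqM uz (bounded_seq_cst nat w); exists C => N.
by apply: le_trans (zC N); rewrite mulrBl mulrA mulrnAl.
Qed.

(** With [S] the partial sum of the [N] first terms, [k N |z| <= |S z| + C] and
    [|S z| <= 2 r^2 N |z|]. As [2 <= k], this gives [N (2 - 2 r^2) |z| <= C] for every [N], which
    the Archimedean property refutes unless [z = 0]. *)
Lemma has_mean_sqr_eq0 (d : nat -> A) (r : R) z k :
  (forall m, nrm (d m) <= r) -> r < 1 -> (2 <= k)%N ->
  has_mean (fun m => (d m * d m) *+ 2) z k -> z = 0.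
Proof.
move=> dr r1 k2 [C dC]; apply: nrm_eq0; apply/eqP; apply: contraT => z0.
have r0 : 0 <= r := le_trans (nrm_nneg _) (dr 0).
have zgt0 : 0 < nrm z by rewrite lt_neqAle eq_sym z0 nrm_nneg.
pose e := (2 - 2 * (r * r)) * nrm z.
have e0 : 0 < e.
  rewrite mulr_gt0// subr_gt0 gtr_pMr// -[ltRHS]mulr1.
  by apply: ltr_pM.
have eC N : N%:R * e <= C.
  pose S := \sum_(m < N) (d m * d m) *+ 2.
  have SN : nrm (S * z) <= N%:R * (2 * (r * r)) * nrm z.
    apply: le_trans (nrmM _ _) _; apply: ler_wpM2r; first exact: nrm_nneg.
    apply: nrm_sum_le (fun m => (d m * d m) *+ 2) _ _ _ => m.
    rewrite nrmMn ler_wpM2l//; apply: le_trans (nrmM _ _) _.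
    by apply: ler_pM; rewrite ?nrm_nneg ?dr.
  have zN : nrm (z *+ (k * N)) <= nrm (S * z) + C.
    rewrite -[z *+ _](subKr (S * z)); apply: le_trans (nrmD _ _) _.
    by rewrite nrmN lerD2l dC.
  have kN : N%:R * 2 * nrm z <= nrm (z *+ (k * N)).
    rewrite nrmMn ler_wpM2r ?nrm_nneg// -natrM ler_nat mulnC.
    by rewrite leq_mul2r k2 orbT.
  rewrite /e mulrA mulrBr mulrBl lerBlDl.
  exact: le_trans kN (le_trans zN (lerD SN (lexx C))).
have C0 : 0 <= C by have := eC 0; rewrite mul0r.
have := archi_boundP (divr_ge0 C0 (ltW e0)).
by rewrite ltr_pdivrMr// ltNge eC.
Qed.

(** * A single cosine sequence *)

Section Cosine.
Variable c : int -> A.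
Hypothesis cos_c : cosine_sequence c.

Lemma cosineM (m n : int) : (c m * c n) *+ 2 = c (m + n) + c (m - n).
Proof. by rewrite -cos_c.2 -mulrA mulr_natl. Qed.

Lemma cosineD (m n : int) : c (m + n) = (c m * c n) *+ 2 - c (m - n).
Proof. by rewrite cosineM addrK. Qed.

Lemma cosine_double_fix z : c 2 * z = z ->
  has_mean (fun m => c (m + m)%N) z 1.
Proof.
move=> cz; apply: has_mean_fix => m; rewrite mulr1n.
(* Two consecutive even indices are carried along, since [c (p + 2) = 2 c p c 2 - c (p - 2)] has
   order two. *)
suff: c (m + m)%N * z = z /\ c (m.+1 + m.+1)%N * z = z by case.
elim: m => [|m [IH1 IH2]]; first by rewrite cos_c.1 mul1r cz.
split=> //; set p := (m.+1 + m.+1)%N in IH2 *.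
have -> : (m.+2 + m.+2)%N%:Z = p%:Z + 2.
  by rewrite /p -!PoszD; congr Posz; rewrite !addnS addn0 !addSn.
have pm : p%:Z - 2 = (m + m)%N.
  by rewrite /p addnS addSn -[X in Posz X]addn2 PoszD addrK.
by rewrite cosineD pm mulrBl IH1 mulrnAl -mulrA cz IH2 mulr2n addrK.
Qed.

(** [2 c (2 m) (c 2 - 1)] is the second difference [c (2 m + 2) - 2 c (2 m) + c (2 m - 2)], so it
    telescopes through the first differences. *)
Lemma cosine_double_mean z : bounded_seq c ->
  has_mean (fun m => c (m + m)%N) ((c 2 - 1) * z) 0.
Proof.
move=> bc.
apply: (@has_mean_telescope _
  (fun m => (c (m + m)%N - c ((m + m)%N%:Z - 2)) * z)).
  have [C cC] := bc; apply: bounded_seqM; last exact: bounded_seq_cst.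
  by apply: bounded_seqD; [|apply: bounded_seqN]; exists C => m; exact: cC.
move=> m; rewrite mulrA -mulrBl -mulrnAl mulrBr mulr1 mulrnBl cosineM.
have -> : (m.+1 + m.+1)%N%:Z = (m + m)%N%:Z + 2.
  by rewrite addnS addSn -addn2 PoszD.
by rewrite addrK opprB [c _ *+ 2]mulr2n [- (c _ + _)]opprD addrACA.
Qed.

(** [c 2] is a polynomial in [c 1]. This lets [c 1 - b 1] be moved past [b 2] and [c 2] later. *)
Lemma cosine_comm12 : GRing.comm (c 1) (c 2).
Proof.
have -> : c 2 = (c 1 * c 1) *+ 2 - 1.
  by have := cosineD 1 1; rewrite subrr cos_c.1.
apply: commrB; last exact: commr1.
by apply: commrMn; apply: commrM.
Qed.

End Cosine.

(** * Two cosine sequences *)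

Section Pair.
Variables b c : int -> A.
Hypothesis cos_b : cosine_sequence b.
Hypothesis cos_c : cosine_sequence c.
Hypothesis bc_comm : forall m n, GRing.comm (b m) (c n).

(* A discrete Christoffel-Darboux identity: the products [b m * c m],
   multiplied by [c 1 - b 1], telescope. *)
Lemma cosine_pair_mean : bounded_seq b -> bounded_seq c ->
  has_mean (fun m => b m * c m) (c 1 - b 1) 0.
Proof.
move=> [B bB] [C cC].
(* The telescoping sequence is the discrete Wronskian of [b] and [c]; at [m = 0] it uses the index
   -1. *)
apply: (@has_mean_telescope _
  (fun m : nat => b (m%:Z - 1) * c m - b m * c (m%:Z - 1))).
  by apply: bounded_seqD; [|apply: bounded_seqN]; apply: bounded_seqM;
    [exists B | exists C | exists B | exists C] => m; rewrite ?bB ?cC.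
move=> m; rewrite mulrBr mulrnBl -mulrA -mulrnAr cosineM//.
rewrite -mulrA -(bc_comm 1 m) mulrA -mulrnAl cosineM//.
rewrite mulrDr mulrDl.
have -> : m.+1%:Z = m%:Z + 1 by rewrite -addn1 PoszD.
rewrite addrK.
set p := b m * c (m%:Z + 1); set q := b m * c (m%:Z - 1).
set s := b (m%:Z + 1) * c m; set t := b (m%:Z - 1) * c m.
by rewrite opprD opprB addrACA.
Qed.

End Pair.

Lemma eq_cosine (b c : int -> A) : cosine_sequence b -> cosine_sequence c ->
  b 1 = c 1 -> forall n, b n = c n.
Proof.
move=> cos_b cos_c e1.
have ebc (m : nat) : b m = c m.
  suff: b m = c m /\ b m.+1 = c m.+1 by case.
  elim: m => [|m [IH1 IH2]]; first by rewrite cos_b.1 cos_c.1.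
  split=> //; have -> : m.+2%:Z = m.+1%:Z + 1 by rewrite -addn1 PoszD.
  rewrite (cosineD cos_b) (cosineD cos_c) IH2 e1; congr (_ - _).
  by rewrite -[m.+1]addn1 PoszD addrK.
(* The cosine equation at [(0, n)] reads [2 a n = a n + a (- n)]. *)
have even (a : int -> A) : cosine_sequence a -> forall n, a (- n) = a n.
  move=> cos_a n; have := cosineM cos_a 0 n.
  by rewrite cos_a.1 mul1r !add0r mulr2n => /addrI.
by case=> m; rewrite ?NegzE ?even.
Qed.

Theorem commuting_cosine_eq (b c : int -> A) (r : R) :
  cosine_sequence b -> cosine_sequence c ->
  (forall m n, GRing.comm (b m) (c n)) -> bounded_seq b ->
  (forall n, nrm (c n - b n) <= r) -> r < 1 ->
  forall n, c n = b n.
Proof.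
move=> cos_b cos_c bc_comm bb dr r1.
have bc : bounded_seq c.
  have [C cC] := bounded_seqD (ex_intro _ r dr) bb.
  by exists C => n; rewrite -[c n](subrK (b n)).
pose x := c 1 - b 1.
have b2x : GRing.comm (b 2) x.
  by apply: commrB; [exact: bc_comm | apply/commr_sym/(cosine_comm12 _)].
have c2x : GRing.comm (c 2) x.
  apply: commrB; first by apply/commr_sym/(cosine_comm12 _).
  exact/commr_sym/bc_comm.
(* Each doubled square [2 (c m)^2 = c (2 m) + c 0] contributes one of the two units; commutation
   merges the cross terms. *)
have sqrE m : ((c m - b m) * (c m - b m)) *+ 2 =
    1 + 1 + c (m + m) + b (m + m) + (- 4%:R) * (b m * c m).
  have bcE := bc_comm m m.
  rewrite mulNr mulr_natl mulrBr !mulrBl -bcE opprB addrACA -opprD -mulr2n.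
  rewrite mulrnBl -mulrnA; congr (_ - _).
  rewrite mulrnDl (cosineM cos_b) (cosineM cos_c) !subrr cos_b.1 cos_c.1.
  by rewrite addrACA addrC addrA.
have key z kb kc : has_mean (fun m => b m * c m) z 0 ->
    has_mean (fun m => b (m + m)%N) z kb ->
    has_mean (fun m => c (m + m)%N) z kc -> z = 0.
  move=> pz bz cz.
  apply: (@has_mean_sqr_eq0 (fun m => c m - b m) r z (2 + kc + kb + 0)) => //.
  have mean2 : has_mean (fun=> 1 + 1) z 2.
    by apply: has_mean_fix => _; rewrite -mulr2n mulr_natl.
  have [C zC] := has_meanD (has_meanD (has_meanD mean2 cz) bz)
    (has_mean0Z (- 4%:R) pz).
  exists C => N; apply: le_trans (zC N).
  by under eq_bigr => m _ do rewrite sqrE.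
(* The mean vanishes on right multiples of [x], whereas the vectors fed to [key] have [x] on the
   right; the commutations below reconcile the two. *)
have pair w : has_mean (fun m => b m * c m) (x * w) 0.
  by apply: has_mean_mulr; exact: cosine_pair_mean.
have b2x1 : GRing.comm x (b 2 - 1) by apply/commrB/commr1/commr_sym.
have c2x1 : GRing.comm x (c 2 - 1) by apply/commrB/commr1/commr_sym.
have pairb : has_mean (fun m => b m * c m) ((b 2 - 1) * x) 0.
  by rewrite -b2x1; exact: pair.
have pairc : has_mean (fun m => b m * c m) ((c 2 - 1) * x) 0.
  by rewrite -c2x1; exact: pair.
have pairbc : has_mean (fun m => b m * c m) ((b 2 - 1) * ((c 2 - 1) * x)) 0.
  by rewrite -c2x1 mulrA -b2x1 -mulrA; exact: pair.
(* [cosine_double_mean] needs its own factor leftmost, for [b] and for [c] in turn. *)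
have bcC w : (b 2 - 1) * ((c 2 - 1) * w) = (c 2 - 1) * ((b 2 - 1) * w).
  rewrite !mulrA; congr (_ * w); apply/commrB/commr1.
  exact/commr_sym/commrB/commr1/commr_sym/bc_comm.
have bfix w : (b 2 - 1) * w = 0 -> has_mean (fun m => b (m + m)%N) w 1.
  move=> /eqP; rewrite mulrBl mul1r subr_eq0 => /eqP bw.
  exact: cosine_double_fix.
have cfix w : (c 2 - 1) * w = 0 -> has_mean (fun m => c (m + m)%N) w 1.
  move=> /eqP; rewrite mulrBl mul1r subr_eq0 => /eqP cw.
  exact: cosine_double_fix.
have bc0 : (b 2 - 1) * ((c 2 - 1) * x) = 0.
  apply: (key _ 0 0)%N => //; first exact: cosine_double_mean.
  by rewrite bcC; exact: cosine_double_mean.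
have c0 : (c 2 - 1) * x = 0.
  by apply: (key _ 1 0)%N => //; [exact: bfix | exact: cosine_double_mean].
have b0 : (b 2 - 1) * x = 0.
  apply: (key _ 0 1)%N => //; first exact: cosine_double_mean.
  by apply: cfix; rewrite -bcC bc0.
have x0 : x = 0.
  apply: (key _ 1 1)%N; [|exact: bfix|exact: cfix].
  by have := pair 1; rewrite mulr1.
by apply: eq_cosine => //; apply/eqP; rewrite -subr_eq0 -/x x0.
Qed.

End CommutingCosineSequences.

(** * Normed algebras and the scalar cosine sequence *)

Lemma algebra_cosine_eq (R : realType) (K : numFieldType) (abs : K -> R)
    (A : algType K) (nrm : A -> R) (a : int -> K) (c : int -> A) :
  is_algebra_norm abs nrm -> abs (- 1) = 1 -> (forall n, abs n%:R = n%:R) ->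
  cosine_sequence a -> (forall n, abs (a n) <= 1) -> cosine_sequence c ->
  (ereal_sup [set (nrm (c n - (a n)%:A))%:E | n in [set: int]] < 1%:E)%E ->
  forall n, c n = (a n)%:A.
Proof.
move=> [nrm_eq0 nrmD nrmZ nrmM] absN1 absn cos_a a1 cos_c sup1.
have nrmN x : nrm (- x) = nrm x by rewrite -scaleN1r nrmZ absN1 mul1r.
have nrmMn x n : nrm (x *+ n) = n%:R * nrm x by rewrite -scaler_nat nrmZ absn.
have cos_aA : cosine_sequence (fun n => (a n)%:A : A).
  split=> [|m n]; first by rewrite cos_a.1 scale1r.
  by rewrite -mulrA mulr_natl -scalerAl mul1r scalerA -scaler_nat scalerA
    mulrA cos_a.2 scalerDl.
set S := ereal_sup _ in sup1.
have dS n : ((nrm (c n - (a n)%:A))%:E <= S)%E.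
  by apply: ereal_sup_ubound; exists n.
(* The supremum lies between a real norm and 1, so its real value can serve as the constant
   [r < 1]. *)
have Sfin : S \is a fin_num.
  rewrite fin_numE; apply/andP; split.
    by rewrite gt_eqF// (lt_le_trans (ltNyr _) (dS 0)).
  by rewrite lt_eqF// (lt_trans sup1 (ltry _)).
apply: (commuting_cosine_eq nrm_eq0 nrmD nrmN nrmMn nrmM cos_aA cos_c
  (r := fine S)).
- by move=> m n; rewrite /GRing.comm -scalerAl -scalerAr mul1r mulr1.
- exists (nrm 1) => n; rewrite nrmZ ler_piMl//.
  exact: nrm_nneg nrmD nrmN nrmMn _.
- by move=> n; rewrite -lee_fin fineK.
- by rewrite -lte_fin fineK.
Qed.

Lemma cosine_scalar_cosine (R : rcfType) (gamma : R[i]) :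
  gamma != 0 -> cosine_sequence (scalar_cosine gamma).
Proof.
move=> g0; rewrite /scalar_cosine; split=> [|m n].
  by rewrite oppr0 expr0z divff// pnatr_eq0.
rewrite !opprD !opprK !expfzDr// -!invr_expz.
have := expfz_neq0 m g0; have := expfz_neq0 n g0.
by move: (gamma ^ m) (gamma ^ n) => x y y0 x0; field; rewrite x0 y0.
Qed.

Lemma norm_scalar_cosine (R : rcfType) (gamma : R[i]) (n : int) :
  `|gamma| = 1 -> `|scalar_cosine gamma n| <= 1.
Proof.
move=> g1; have gX (k : int) : `|gamma ^ k| = 1.
  by case: k => k; rewrite /exprz ?normfV normrX g1 expr1n ?invr1.
rewrite normrM normfV [`|2|]ger0_norm// ler_pdivrMr// mul1r.
apply: le_trans (ler_normD _ _) _.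
by rewrite !gX.
Qed.

Theorem theorem2 (R : realType) (gamma : R[i]) (hgamma : `|gamma| = 1) :
  (forall (A : algType R) (nrm : A -> R) (c : int -> A),
     is_algebra_norm (fun k : R => `|k|) nrm ->
     cosine_sequence c ->
     (ereal_sup [set (nrm (c n - (complex.Re (scalar_cosine gamma n))%:A))%:E
                | n in [set: int]] < 1%:E)%E ->
     forall n : int, c n = (complex.Re (scalar_cosine gamma n))%:A)
  /\
  (forall (A : algType R[i]) (nrm : A -> R) (c : int -> A),
     is_algebra_norm (fun k : R[i] => complex.Re `|k|) nrm ->
     cosine_sequence c ->
     (ereal_sup [set (nrm (c n - (scalar_cosine gamma n)%:A))%:E
                | n in [set: int]] < 1%:E)%E ->
     forall n : int, c n = (scalar_cosine gamma n)%:A).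
Proof.
have g0 : gamma != 0 by rewrite -normr_eq0 hgamma oner_neq0.
have cos_g := cosine_scalar_cosine g0.
have g_le1 n := norm_scalar_cosine n hgamma.
have gE n : scalar_cosine gamma n = (complex.Re (scalar_cosine gamma n))%:C.
  by case: (scalar_cosine_real n hgamma).
split=> A nrm c nrmA cos_c.
  apply: (algebra_cosine_eq nrmA) => //.
  - by rewrite normrN1.
  - by move=> n; rewrite normr_nat.
  (* The cosine equation for the real parts is pulled back along the injective embedding of [R] into
     [R[i]]. *)
  - split=> [|m n]; apply: complexI.
      by rewrite -gE cos_g.1.
    by rewrite rmorphD !rmorphM rmorph_nat /= -!gE cos_g.2.
  - by move=> n; rewrite -lecR; exact: le_trans (normc_ge_Re _) (g_le1 n).
apply: (algebra_cosine_eq nrmA) => //.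
- by rewrite normrN1.
- by move=> n; rewrite normr_nat -(rmorph_nat (real_complex R)).
- by move=> n; have := g_le1 n; rewrite lecE => /andP[].
Qed.
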